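(* Work over $\mathbb{C}$. Fix seven distinct points on a twisted cubic in $\mathbb{P}^3$, and let $H_1,\ldots,H_7$ be seven planes in $\mathbb{P}^3$ whose union contains the $21$ lines spanned by pairs of the seven points (each one of these planes has to contain exactly three of the seven points). Let $I=\{i_1<\ldots<i_6\}\subseteq\{1,\ldots,7\}$ be a $6$-element subset with complement $\{j\}$. Then the intersection of the following three planes is a point, and it lies on $H_j$: \begin{itemize} \item the linear span of $H_{i_1}\cap H_{i_2}$ with the point $H_{i_4}\cap H_{i_5}\cap H_{j}$; \item the linear span of $H_{i_2}\cap H_{i_3}$ with the point $H_{i_5}\cap H_{i_6}\cap H_{j}$; \item the linear span of $H_{i_3}\cap H_{i_4}$ with the point $H_{i_6}\cap H_{i_1}\cap H_{j}$. \end{itemize}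
   Context: A twisted cubic is a rational normal curve in $\mathbb{P}^3$, i.e. a smooth rational curve of degree $3$ in $\mathbb{P}^3$ (unique up to projective isomorphism; the image of $[s:t]\mapsto[s^3:s^2t:st^2:t^3]$ up to a projective change of coordinates).
   Formalization: The claim about the three planes is proved assuming that any three of the seven planes H_1,…,H_7 meet in exactly a point; without this it fails, e.g. if H_{i_1}, H_{i_2}, H_{i_3} share a line. *)

(* Defs.v *)
(* The field of complex numbers is R[i] for R : realType. *)
From HB Require Import structures.
From mathcomp Require Export all_boot all_order all_algebra.
From mathcomp Require Export complex.
From mathcomp Require Export reals.

Set Implicit Arguments.
Unset Strict Implicit.
Unset Printing Implicit Defensive.

Import Order.TTheory GRing.Theory Num.Theory.
Local Open Scope ring_scope.

(* Linear subspaces of P^3 are the vector subspaces of C^4, the projective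
   dimension being one less than '\dim': intersection is ':&:', linear span is
   '+', inclusion is '<='. *)
Definition P3sub (R : realType) := {vspace 'rV[R[i]]_4}.

Definition is_point (R : realType) (U : P3sub R) : Prop := \dim U = 1%N.
Definition is_plane (R : realType) (U : P3sub R) : Prop := \dim U = 3%N.

(* (s^3, s^2 t, s t^2, t^3) *)
Definition cubic_param (R : realType) (s t : R[i]) : 'rV[R[i]]_4 :=
  \row_(k < 4) (s ^+ (3 - k) * t ^+ k).

(* A curve in P^3 is given by the collection of its points. *)
Definition twisted_cubic (R : realType) (T : P3sub R -> Prop) : Prop :=
  exists2 A : 'M[R[i]]_4, A \in unitmx &
    forall U : P3sub R,
      T U <-> exists s t : R[i],
                (s, t) != (0, 0) /\ U = <[cubic_param s t *m A]>%VS.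

Definition covers_secants (R : realType) (P H : 'I_7 -> P3sub R) : Prop :=
  forall a b : 'I_7, a != b ->
  forall x : P3sub R, is_point x -> (x <= P a + P b)%VS ->
  exists k : 'I_7, (x <= H k)%VS.

(* Not automatic for planes covering the secants of seven points on a twisted
   cubic: for the points of parameters 0, 1, -1, 2, -2, 3, -3, the planes
   through {0, 1, -1}, {0, 2, -2} and {0, 3, -3} contain a common line. *)
Definition triples_meet_in_points (R : realType) (H : 'I_7 -> P3sub R) : Prop :=
  forall a b c : 'I_7, uniq [:: a; b; c] -> is_point (H a :&: H b :&: H c)%VS.

(* Main.v *)
Require Import Defs.
From mathcomp Require Import ring zify.

Set Implicit Arguments.
Unset Strict Implicit.
Unset Printing Implicit Defensive.

Import Order.TTheory GRing.Theory Num.Theory.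
Local Open Scope ring_scope.

(** Why the theorem holds.

  A plane cuts the twisted cubic in the roots of a binary cubic form, so it
  contains at most three of the seven points, hence at most three of the 21
  secants.  Seven planes covering all the secants therefore contain exactly
  three points each, and every secant lies in exactly one of them
  ([fano_of_cover]): the incidence structure is the Fano plane, in the labelling
  of [fano_labelling].  In the affine parameter [tau] of the curve the plane
  through [x], [y], [z] becomes, up to a scalar, the cubic polynomial
  [(X - tau x) (X - tau y) (X - tau z)].

  The heart of the matter is that these seven planes osculate a second twisted
  cubic ([seven_cubics_on_twisted_cubic]), a theorem of H. S. White: the seven
  cubic polynomials lie on a twisted cubic of the dual space.  Take as a basis
  the four cubics [q_i] of the lines that avoid a point [p] of the Fano plane.
  Suitably rescaled, they express the other three as [sum_i q_i / y_i],
  [sum_i q_i / z_i] and [sum_i q_i / (y_i + z_i)]; in other words the standard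
  Cremona transformation sends those three points to three points of one line,
  and it sends that line back to the twisted cubic
  [(s, t) |-> sum_i q_i / (s y_i + t z_i)], which also passes through the four
  points [q_i] ([twisted_cubic_of_frame]).  The argument needs seven
  determinants to be nonzero, one for each of the seven points: the determinant
  attached to [x] vanishes exactly when the other six points, paired by the
  three lines through [x], are in involution, and then the three planes through
  that point share a line ([involution_det_eq0]).  So the assumption
  that three planes always meet in a point is what keeps them nonzero.

  Once [H_k] is the osculating plane at a parameter [u_k], points of the space
  become cubic polynomials and [H_k] consists of those vanishing at [u_k].  The
  span of [H_a :&: H_b] with the point [H_c :&: H_d :&: H_e] is the plane that
  fixes the ratio of the values at [u_a] and [u_b] to be the one taken by
  [(X - u_c) (X - u_d) (X - u_e)] ([span_line_point]).  The three planes of the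
  theorem thus prescribe the ratios of the values at [u_1, u_2, u_3, u_4], which
  determine a cubic polynomial up to a scalar, and Lagrange interpolation shows
  that it vanishes at [u_j] ([span_planes_meet]). *)

(** * Binary cubics as row vectors *)

Section Cubics.
Variable F : fieldType.

Definition moment (s t : F) : 'rV[F]_4 := \row_(k < 4) (s ^+ (3 - k) * t ^+ k).

Definition row4 (x y z t : F) : 'rV[F]_4 := \row_(k < 4) [:: x; y; z; t]`_k.

(** The coefficients of [(X - a) (X - b) (X - c)], lowest degree first, so that
  pairing with [moment 1 t] evaluates the polynomial at [t]. *)
Definition cubic (a b c : F) : 'rV[F]_4 :=
  row4 (- (a * b * c)) (a * b + b * c + c * a) (- (a + b + c)) 1.

Lemma moment_cubic a b c t :
  (moment 1 t *m (cubic a b c)^T) 0 0 = (t - a) * (t - b) * (t - c).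
Proof. by rewrite !mxE !big_ord_recl big_ord0 !mxE /= /bump /=; ring. Qed.

Lemma moment_rVpoly (g : 'rV[F]_4) t :
  (moment 1 t *m g^T) 0 0 = (rVpoly g).[t].
Proof.
rewrite mxE (horner_coef_wide _ (size_poly _ _)); apply: eq_bigr => k _.
by rewrite coef_rVpoly_ord !mxE expr1n mul1r mulrC.
Qed.

Lemma rVpoly_eq0 (g : 'rV[F]_4) : (rVpoly g == 0) = (g == 0).
Proof.
apply/eqP/eqP=> [E|->]; last exact: linear0.
by rewrite -[g]rVpolyK E linear0.
Qed.

Lemma cubic_max_roots (g : 'rV[F]_4) (rs : seq F) :
  g != 0 -> uniq rs -> {in rs, forall t, moment 1 t *m g^T = 0} ->
  (size rs <= 3)%N.
Proof.
move=> g0 urs rt; rewrite -ltnS; apply: leq_trans (size_poly 4 _).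
apply: (@max_poly_roots _ (rVpoly g)) => //; first by rewrite rVpoly_eq0.
by apply/allP=> t /rt E; rewrite rootE -moment_rVpoly E mxE.
Qed.

Lemma cubic_of_roots (g : 'rV[F]_4) a b c :
  uniq [:: a; b; c] -> g != 0 ->
  {in [:: a; b; c], forall t, moment 1 t *m g^T = 0} ->
  exists2 k, k != 0 & g = k *: cubic a b c.
Proof.
move=> uabc g0 rt.
(* Subtracting the right multiple of the cubic leaves degree at most 2. *)
pose k := g 0 (inord 3); pose d := g - k *: cubic a b c.
suff d0 : d = 0.
  have E : g = k *: cubic a b c by apply/eqP; rewrite -subr_eq0 -/d d0.
  by exists k => //; apply: contra_neq g0 => k0; rewrite E k0 scale0r.
apply/eqP; rewrite -rVpoly_eq0; apply/negPn/negP => d0.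
suff: (size [:: a; b; c] < size (rVpoly d))%N.
  rewrite ltnNge => /negP[]; apply/leq_sizeP => j; rewrite leq_eqVlt.
  case/predU1P => [<-|lj]; last first.
    by apply: nth_default; apply: leq_trans (size_poly _ _) lj.
  have := coef_rVpoly_ord d (inord 3); rewrite inordK // => ->.
  by rewrite !mxE inordK //= mulr1 subrr.
apply: max_poly_roots => //; apply/allP => t tabc.
rewrite rootE -moment_rVpoly linearB linearZ /= mulmxBr -scalemxAr rt // sub0r.
rewrite mxE mxE moment_cubic; move: tabc; rewrite !inE.
by case/or3P => /eqP->; rewrite subrr ?mulr0 ?mul0r ?mulr0 ?oppr0.
Qed.

(** Up to sign, the determinant of the three rows [(1, x + y, x y)] for the pairs
  [(a, b)], [(c, d)], [(e, f)]: it vanishes when the pairs belong to one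
  involution of the projective line. *)
Definition involution_det (a b c d e f : F) : F :=
  (c + d - (a + b)) * (e * f - a * b) - (e + f - (a + b)) * (c * d - a * b).

(** Three pairs in involution are linearly dependent quadratic polynomials;
  multiplying by a common linear factor gives dependent cubics. *)
Lemma involution_det_eq0 (x y1 z1 y2 z2 y3 z3 : F) :
  involution_det y1 z1 y2 z2 y3 z3 = 0 ->
  exists k1 k2 k3, (k1, k2, k3) != (0, 0, 0) /\
    k1 *: cubic x y1 z1 + k2 *: cubic x y2 z2 + k3 *: cubic x y3 z3 = 0.
Proof.
rewrite /involution_det.
set v1 := y2 + z2 - _; set v2 := y2 * z2 - _.
set w1 := y3 + z3 - _; set w2 := y3 * z3 - _ => D.
(* A relation between the plane vectors v and w, completed by the coefficient
   that cancels the leading terms of the three monic cubics. *)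
suff [k2 [k3 [k0 E1 E2]]] : exists k2 k3,
    [/\ (k2, k3) != (0, 0), k2 * v1 + k3 * w1 = 0 & k2 * v2 + k3 * w2 = 0].
  exists (- (k2 + k3)), k2, k3; split.
    by apply: contraNneq k0 => -[_ -> ->].
  apply/rowP=> j; rewrite !mxE.
  case: j => [[|[|[|[|//]]]] ?] /=.
  - transitivity (- x * (k2 * v2 + k3 * w2)); last by rewrite E2 mulr0.
    by rewrite /v2 /w2; ring.
  - transitivity (x * (k2 * v1 + k3 * w1) + (k2 * v2 + k3 * w2)).
      by rewrite /v1 /w1 /v2 /w2; ring.
    by rewrite E1 E2 mulr0 addr0.
  - transitivity (- (k2 * v1 + k3 * w1)); last by rewrite E1 oppr0.
    by rewrite /v1 /w1; ring.
  - ring.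
have [v10|v10] := eqVneq v1 0; last first.
  exists w1, (- v1); split; last 2 first.
  - ring.
  - by rewrite -[RHS]oppr0 -D; ring.
  by rewrite xpair_eqE oppr_eq0 (negPf v10) andbF.
have [v20|v20] := eqVneq v2 0; last first.
  exists w2, (- v2); split; last 2 first.
  - by apply: etrans D; ring.
  - ring.
  by rewrite xpair_eqE oppr_eq0 (negPf v20) andbF.
exists 1, 0; split; last 2 first; rewrite ?v10 ?v20 ?mulr0 ?mul0r ?addr0 //.
by rewrite xpair_eqE oner_eq0.
Qed.

(** * Twisted cubics through a frame *)

(** The matrix of the map [(s, t) |-> (prod_(l != i) (s y_l + t z_l))_i] in the
  monomials of degree 3, where [l m] runs through the three indices other
  than [i]. *)
Definition cofactors (y z : 'I_4 -> F) : 'M[F]_4 :=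
  \matrix_(k < 4, i < 4)
    let l m : 'I_4 := lift i (m : 'I_3) in
    let a := l 0 in let b := l 1 in let c := l (inord 2) in
    [:: y a * y b * y c;
        y a * y b * z c + y a * z b * y c + z a * y b * y c;
        y a * z b * z c + z a * y b * z c + z a * z b * y c;
        z a * z b * z c]`_k.

Lemma moment_cofactors y z s t (i : 'I_4) :
  (moment s t *m cofactors y z) 0 i =
  \prod_(m < 3) (s * y (lift i m) + t * z (lift i m)).
Proof.
rewrite !mxE !big_ord_recl !big_ord0 !mxE /=.
have -> : lift ord0 (lift ord0 (ord0 : 'I_1)) = inord 2 :> 'I_3.
  by apply/val_inj; rewrite /= inordK.
have -> : lift ord0 (ord0 : 'I_2) = 1 :> 'I_3 by apply/val_inj.
have -> : ord0 = 0 :> 'I_3 by [].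
rewrite /bump /=; ring.
Qed.

(** The Cremona transformation [(x_i) |-> (1 / x_i)] of the basis [row i Q] turns
  the line of the points [s y + t z] into a twisted cubic, once denominators are
  cleared.  The line crosses the [i]-th coordinate plane at the parameter
  [(z_i, - y_i)], where the curve passes through the [i]-th basis vector; the
  hypothesis on [y] and [z] says that these four parameters are distinct. *)
Lemma twisted_cubic_of_frame (Q : 'M[F]_4) (y z : 'I_4 -> F) :
    Q \in unitmx -> (forall i j, i != j -> y i * z j != y j * z i) ->
  exists2 B : 'M[F]_4, B \in unitmx &
    (forall i, exists2 c, c != 0 &
       row i Q = c *: (moment (z i) (- y i) *m B)) /\
    (forall s t, (forall i, s * y i + t * z i != 0) ->
       exists2 c, c != 0 &
         \sum_i (s * y i + t * z i)^-1 *: row i Q = c *: (moment s t *m B)).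
Proof.
move=> uQ yz; pose B := cofactors y z *m Q.
pose d i := \prod_(m < 3) (z i * y (lift i m) + - y i * z (lift i m)).
have d0 i : d i != 0.
  apply/prodf_neq0 => m _; rewrite mulNr subr_eq0 [z i * _]mulrC.
  by apply: yz; rewrite eq_sym neq_lift.
have mC i : moment (z i) (- y i) *m cofactors y z = d i *: delta_mx 0 i.
  apply/rowP=> j; rewrite moment_cofactors !mxE /=.
  case: eqVneq => [->|ij]; first by rewrite mulr1.
  rewrite mulr0; case: (unliftP j i) ij => [m Em _|->]; last by rewrite eqxx.
  by rewrite (bigD1 m) //= -Em; ring.
have mB i : moment (z i) (- y i) *m B = d i *: row i Q.
  by rewrite mulmxA mC -scalemxAl rowE.
exists B; last split.
- rewrite unitmx_mul uQ andbT.
  (* Evaluating at the four special parameters makes the matrix diagonal. *)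
  pose D := \matrix_i moment (z i) (- y i).
  have : D *m cofactors y z = diag_mx (\row_i d i).
    apply/row_matrixP => i; rewrite row_mul rowK mC; apply/rowP => j.
    rewrite !mxE !eqxx /=.
    by case: (eqVneq i j) => [->|ij]; rewrite ?mulr1 ?mulr1n // mulr0.
  move=> E; have : D *m cofactors y z \in unitmx.
    rewrite E unitmxE det_diag unitfE; apply/prodf_neq0 => i _.
    by rewrite mxE.
  by rewrite unitmx_mul => /andP[].
- move=> i; exists (d i)^-1; first by rewrite invr_eq0.
  by rewrite mB scalerA mulVf ?scale1r.
- move=> s t st0; exists (\prod_i (s * y i + t * z i))^-1.
    by rewrite invr_eq0; apply/prodf_neq0 => i _.
  rewrite mulmxA; apply: (can_inj (mulmxKV uQ)).
  rewrite -scalemxAl mulmxK // mulmx_suml; apply/rowP => j.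
  rewrite [RHS]mxE moment_cofactors summxE (bigD1 j) //= big1 ?addr0 => [|i ij].
    rewrite -scalemxAl rowE mulmxK // !mxE !eqxx mulr1.
    rewrite (bigD1_ord j) //= invfM -mulrA mulVf ?mulr1 //.
    by apply/prodf_neq0 => i _.
  by rewrite -scalemxAl rowE mulmxK // !mxE eq_sym (negPf ij) andbF mulr0.
Qed.

(** * The seven cubics of a Fano plane lie on a twisted cubic *)

Definition rows4 (p q r s : 'rV[F]_4) : 'M_4 :=
  \matrix_(i < 4) [:: p; q; r; s]`_i.

(** The four lines of a Fano plane that avoid a point [p] form a complete
  quadrilateral; its pairs of opposite vertices [(a, a')], [(b, b')], [(c, c')]
  lie on the three lines through [p]. *)
Lemma det_quadrilateral a a' b b' c c' :
  \det (rows4 (cubic a b c) (cubic a b' c') (cubic a' b c') (cubic a' b' c)) =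
  (a - a') * (b - b') * (c - c') * involution_det a a' b b' c c'.
Proof.
rewrite /involution_det (expand_det_row _ (@ord0 3)).
do 4! (rewrite big_ord_recl); rewrite big_ord0 /cofactor.
rewrite !(expand_det_row _ (@ord0 2)).
rewrite !(big_ord_recl 2) !(big_ord_recl 1) !(big_ord_recl 0) !big_ord0.
rewrite /cofactor !(expand_det_row _ (@ord0 1)).
rewrite !(big_ord_recl 1) !(big_ord_recl 0) !big_ord0 /cofactor.
rewrite !det_mx11 !mxE /=; ring.
Qed.

Definition on_twisted_cubic (B : 'M[F]_4) (q : 'rV[F]_4) : Prop :=
  exists s t k, k != 0 /\ q = k *: (moment s t *m B).

Lemma on_twisted_cubicZ B k q :
  k != 0 -> on_twisted_cubic B (k *: q) -> on_twisted_cubic B q.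
Proof.
move=> k0 [s [t [l [l0 E]]]]; exists s, t, (k^-1 * l); split.
  by rewrite mulf_neq0 ?invr_eq0.
by rewrite -scalerA -E scalerA mulVf ?scale1r.
Qed.

(** White's theorem.  Each nonvanishing hypothesis belongs to one point of the
  Fano plane and pairs the other six points by the lines through it.  The frame
  consists of the four cubics of the quadrilateral; the identities that remain
  are polynomial. *)
Lemma seven_cubics_on_twisted_cubic a a' b b' c c' p :
  let Ia := involution_det b c c' b' p a' in
  let Ib := involution_det a c c' a' p b' in
  let Ic := involution_det a b b' a' p c' in
  let Ia' := involution_det b c' c b' p a in
  let Ib' := involution_det a c' c a' p b in
  let Ic' := involution_det a b' b a' p c in
  let Ip := involution_det a a' b b' c c' in
  uniq [:: a; a'; b; b'; c; c'; p] ->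
  [/\ Ia != 0, Ib != 0, Ic != 0 & Ip != 0] ->
  [/\ Ia' != 0, Ib' != 0 & Ic' != 0] ->
  exists2 B : 'M[F]_4, B \in unitmx &
    [/\ on_twisted_cubic B (cubic a b c), on_twisted_cubic B (cubic a b' c'),
        on_twisted_cubic B (cubic a' b c') &
        on_twisted_cubic B (cubic a' b' c)] /\
    [/\ on_twisted_cubic B (cubic p a a'), on_twisted_cubic B (cubic p b b') &
        on_twisted_cubic B (cubic p c c')].
Proof.
move=> Ia Ib Ic Ia' Ib' Ic' Ip U [Ia0 Ib0 Ic0 Ip0] [Ia'0 Ib'0 Ic'0].
have N (x y : F) : x != y -> y != x by rewrite eq_sym.
move: U; rewrite /= !inE !negb_or -!andbA.
do 20! (case/andP=> /[dup] /N ? ?); case/andP=> /[dup] /N ? ? _.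
(* The i-th basis cubic is scaled by the Vandermonde product of the three
   vertices off the i-th line; this makes the coordinates y and z polynomial. *)
pose V := [:: (a' - b') * (a' - c') * (b' - c');
              (a' - c) * (a' - b) * (c - b);
              (b' - c) * (b' - a) * (c - a); (c' - b) * (c' - a) * (b - a)].
(* Inverse coordinates of the cubics through p, proportionally: y for the line
   p a a', z for p b b', and w for p c c'. *)
pose y := [:: (a - a') * (Ia * (b' - c')); - ((a - a') * (Ia * (c - b)));
   - ((a - a') * (Ia' * (b' - c))); (a - a') * (Ia' * (c' - b))].
pose z := [:: - ((b - b') * (Ib * (a' - c'))); - ((b - b') * (Ib' * (a' - c)));
   - ((b - b') * (Ib * (c - a))); - ((b - b') * (Ib' * (c' - a)))].
pose w := [:: - ((c - c') * (Ic * (a' - b'))); - ((c - c') * (Ic' * (a' - b)));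
   (c - c') * (Ic' * (b' - a)); (c - c') * (Ic * (b - a))].
(* The identity behind the theorem: y, z and w are collinear. *)
have yzw (i : 'I_4) : 1 * y`_i + 1 * z`_i = w`_i.
  case: i => [[|[|[|[|//]]]] ?] /=;
  rewrite /Ia /Ib /Ic /Ia' /Ib' /Ic' /involution_det; ring.
pose Q0 := rows4 (cubic a b c) (cubic a b' c') (cubic a' b c') (cubic a' b' c).
pose Q := diag_mx (\row_(i < 4) V`_i) *m Q0.
have rQ i : row i Q = V`_i *: row i Q0.
  by apply/rowP=> k; rewrite /Q mul_diag_mx !mxE.
have V0 (i : 'I_4) : V`_i != 0.
  by case: i => [[|[|[|[|//]]]] ?]; rewrite !mulf_neq0 // ?subr_eq0.
have uQ : Q \in unitmx.
  rewrite unitmx_mul !unitmxE !unitfE det_diag det_quadrilateral.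
  apply/andP; split; last by rewrite !mulf_neq0 // ?subr_eq0.
  by apply/prodf_neq0 => i _; rewrite mxE.
have yz (i j : 'I_4) : i != j -> y`_i * z`_j != y`_j * z`_i.
  wlog lij : i j / (i < j)%N.
    move=> W ij; case: (ltngtP i j) => [l|l|/val_inj E]; first exact: W.
      by rewrite eq_sym; apply: W => //; rewrite eq_sym.
    by rewrite E eqxx in ij.
  move=> _; rewrite -subr_eq0.
  (* The six minors of (y, z) split: up to a sign each is a product of
     differences, of Ip, and of one more involution determinant. *)
  have nz x e u v :
      x = e * ((a - a') * (b - b') * (c - c')) * (Ip * u * v) ->
      e ^+ 2 = 1 -> u != 0 -> v != 0 -> x != 0.
    move=> -> e2 u0 v0; rewrite !mulf_neq0 // ?subr_eq0 //.
    by apply: contra_eq_neq e2 => ->; rewrite expr0n eq_sym oner_eq0.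
  have one2 : (1 : F) ^+ 2 = 1 by rewrite expr1n.
  have mone2 : (-1 : F) ^+ 2 = 1 by rewrite sqrrN expr1n.
  case: i j lij => [[|[|[|[|//]]]] ?] [[|[|[|[|//]]]] ?] //= _.
  - apply: (nz _ 1 Ia (a' - p)) => //; rewrite ?subr_eq0 //.
    rewrite /Ia /Ib /Ib' /Ip /involution_det; ring.
  - apply: (nz _ (-1) Ib (b' - p)) => //; rewrite ?subr_eq0 //.
    rewrite /Ia /Ib /Ia' /Ip /involution_det; ring.
  - apply: (nz _ 1 Ic (c' - p)) => //; rewrite ?subr_eq0 //.
    rewrite /Ia /Ib /Ia' /Ib' /Ip /Ic /involution_det; ring.
  - apply: (nz _ 1 Ic' (c - p)) => //; rewrite ?subr_eq0 //.
    rewrite /Ia /Ib /Ia' /Ib' /Ip /Ic' /involution_det; ring.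
  - apply: (nz _ (-1) Ib' (b - p)) => //; rewrite ?subr_eq0 //.
    rewrite /Ia /Ia' /Ib' /Ip /involution_det; ring.
  - apply: (nz _ 1 Ia' (a - p)) => //; rewrite ?subr_eq0 //.
    rewrite /Ib /Ia' /Ib' /Ip /involution_det; ring.
have [B uB [BQ Bst]] := twisted_cubic_of_frame uQ yz.
have rQE (i : 'I_4) k : (row i Q) 0 k = V`_i * Q0 i k by rewrite rQ !mxE.
exists B => //; split.
  have onQ (q : 'rV[F]_4) (i : 'I_4) :
      [:: cubic a b c; cubic a b' c'; cubic a' b c'; cubic a' b' c]`_i = q ->
      on_twisted_cubic B q.
    move=> <-; rewrite -(rowK (fun i : 'I_4 => _`_i) i) -/Q0.
    apply: (on_twisted_cubicZ (V0 i)); rewrite -rQ.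
    by have [k k0 ->] := BQ i; exists z`_i, (- y`_i), k.
  by split; [apply: (onQ _ (inord 0)) | apply: (onQ _ (inord 1))
           | apply: (onQ _ (inord 2)) | apply: (onQ _ (inord 3))];
     rewrite inordK.
have onS (s t : F) (u : seq F) (q : 'rV[F]_4) (k : F) :
    (forall i : 'I_4, s * y`_i + t * z`_i = u`_i) ->
    (forall i : 'I_4, u`_i != 0) -> k != 0 ->
    (forall j, \sum_(i < 4) (u`_i)^-1 * (V`_i * Q0 i j) = k * q 0 j) ->
    on_twisted_cubic B q.
  move=> uE u0 k0 H; apply: (on_twisted_cubicZ k0).
  have [|l l0 E] := Bst s t; first by move=> i; rewrite uE.
  exists s, t, l; split=> //; rewrite -E; apply/rowP=> j; rewrite mxE -H summxE.
  by apply: eq_bigr => i _; rewrite [RHS]mxE rQE uE.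
have sum4 (u : seq F) j :
    \sum_(i < 4) (u`_i)^-1 * (V`_i * Q0 i j) =
      (u`_0)^-1 * (V`_0 * cubic a b c 0 j) +
      (u`_1)^-1 * (V`_1 * cubic a b' c' 0 j) +
      (u`_2)^-1 * (V`_2 * cubic a' b c' 0 j) +
      (u`_3)^-1 * (V`_3 * cubic a' b' c 0 j).
  by rewrite !big_ord_recl big_ord0 addr0 !addrA !mxE.
split.
- have key j :
      Ia' * ((a' - b') * (a' - c') * cubic a b c 0 j
             - (a' - c) * (a' - b) * cubic a b' c' 0 j)
      - Ia * ((b' - a) * (c - a) * cubic a' b c' 0 j
              - (c' - a) * (b - a) * cubic a' b' c 0 j)
      = Ip * (b - b') * (c - c') * cubic p a a' 0 j.
    rewrite !mxE /Ia /Ia' /Ip /involution_det.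
    case: j => [[|[|[|[|//]]]] ?] /=; ring.
  apply: (onS 1 0 y _ (Ip * (b - b') * (c - c') / (Ia * Ia' * (a - a'))))
    => [i|i||j].
  + by rewrite mul1r mul0r addr0.
  + by case: i => [[|[|[|[|//]]]] ?];
      rewrite ?oppr_eq0 !mulf_neq0 // ?subr_eq0.
  + by rewrite !mulf_neq0 ?invr_eq0 ?mulf_neq0 // ?subr_eq0.
  rewrite sum4 /= [RHS]mulrAC -key.
  move: (cubic _ _ _ 0 j) (cubic _ _ _ 0 j) (cubic _ _ _ 0 j) (cubic _ _ _ 0 j).
  clearbody Ia Ia' => q1 q2 q3 q4.
  by field; do ![apply/andP; split]; rewrite ?oppr_eq0 ?mulf_neq0 // ?subr_eq0.
- have key j :
      Ib' * ((a' - b') * (b' - c') * cubic a b c 0 j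
             + (b' - c) * (b' - a) * cubic a' b c' 0 j)
      + Ib * ((a' - b) * (c - b) * cubic a b' c' 0 j
              + (c' - b) * (b - a) * cubic a' b' c 0 j)
      = Ip * (a - a') * (c - c') * cubic p b b' 0 j.
    rewrite !mxE /Ib /Ib' /Ip /involution_det.
    case: j => [[|[|[|[|//]]]] ?] /=; ring.
  apply: (onS 0 1 z _ (- (Ip * (a - a') * (c - c') / (Ib * Ib' * (b - b')))))
    => [i|i||j].
  + by rewrite mul1r mul0r add0r.
  + by case: i => [[|[|[|[|//]]]] ?];
      rewrite ?oppr_eq0 !mulf_neq0 // ?subr_eq0.
  + by rewrite oppr_eq0 !mulf_neq0 ?invr_eq0 ?mulf_neq0 // ?subr_eq0.
  rewrite sum4 /= [RHS]mulNr [X in _ = - X]mulrAC -key.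
  move: (cubic _ _ _ 0 j) (cubic _ _ _ 0 j) (cubic _ _ _ 0 j) (cubic _ _ _ 0 j).
  clearbody Ib Ib' => q1 q2 q3 q4.
  by field; do ![apply/andP; split]; rewrite ?oppr_eq0 ?mulf_neq0 // ?subr_eq0.
- have key j :
      Ic' * ((a' - c') * (b' - c') * cubic a b c 0 j
             - (c' - b) * (c' - a) * cubic a' b' c 0 j)
      + Ic * ((a' - c) * (c - b) * cubic a b' c' 0 j
              - (b' - c) * (c - a) * cubic a' b c' 0 j)
      = Ip * (a - a') * (b - b') * cubic p c c' 0 j.
    rewrite !mxE /Ic /Ic' /Ip /involution_det.
    case: j => [[|[|[|[|//]]]] ?] /=; ring.
  apply: (onS 1 1 w _ (- (Ip * (a - a') * (b - b') / (Ic * Ic' * (c - c')))))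
    => [//|i||j].
  + by case: i => [[|[|[|[|//]]]] ?];
      rewrite ?oppr_eq0 !mulf_neq0 // ?subr_eq0.
  + by rewrite oppr_eq0 !mulf_neq0 ?invr_eq0 ?mulf_neq0 // ?subr_eq0.
  rewrite sum4 /= [RHS]mulNr [X in _ = - X]mulrAC -key.
  move: (cubic _ _ _ 0 j) (cubic _ _ _ 0 j) (cubic _ _ _ 0 j) (cubic _ _ _ 0 j).
  clearbody Ic Ic' => q1 q2 q3 q4.
  by field; do ![apply/andP; split]; rewrite ?oppr_eq0 ?mulf_neq0 // ?subr_eq0.
Qed.
End Cubics.

(** * Hyperplanes of a four-dimensional space *)

Section Hyperplanes.
Variable F : fieldType.
Implicit Types (g h x : 'rV[F]_4) (U V W : {vspace 'rV[F]_4}).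

Definition hyperplane h : {vspace 'rV[F]_4} := lker (linfun (mulmxr h^T)).

Lemma mem_hyperplane h x : (x \in hyperplane h) = (x *m h^T == 0).
Proof. by rewrite memv_ker lfunE. Qed.

Lemma dim_hyperplane h : h != 0 -> \dim (hyperplane h) = 3.
Proof.
move=> h0; pose f : 'Hom('rV[F]_4, 'rV[F]_1) := linfun (mulmxr h^T).
have := limg_ker_dim f fullv; rewrite capfv dimvf /= dim_matrix.
have -> : \dim (limg f) = 1%N; last by rewrite addn1 => -[].
apply/eqP; rewrite eqn_leq lt0n dimv_eq0; apply/andP; split.
  by apply: leq_trans (dimvS (subvf _)) _; rewrite dimvf /= dim_matrix.
apply: contra_neq h0 => f0; apply/rowP => k.
have : f (delta_mx 0 k) \in limg f by rewrite memv_img ?memvf.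
rewrite f0 memv0 lfunE /= -rowE => /eqP /matrixP /(_ 0 0).
by rewrite !mxE.
Qed.

Lemma hyperplaneP U : \dim U = 3 -> exists2 h, h != 0 & U = hyperplane h.
Proof.
move=> dU; pose E : 'M_(3, 4) := \matrix_(i < 3) (vbasis U)`_i.
have : cokermx E != 0.
  by rewrite -mxrank_eq0 mxrank_coker subn_eq0 -ltnNge ltnS rank_leq_row.
rewrite -trmx_eq0 => /rowV0Pn[h /submxP[D hD] h0].
exists h => //; apply/eqP; rewrite eqEdim dim_hyperplane // dU leqnn andbT.
apply/subvP=> x /coord_vbasis ->; rewrite memv_suml // => i _; rewrite memvZ //.
have li : (i < 3)%N by case: i => i /=; rewrite dU.
have -> : (vbasis U)`_i = row (Ordinal li) E by rewrite rowK.
rewrite mem_hyperplane hD trmx_mul trmxK mulmxA -row_mul mulmx_coker.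
by rewrite row0 mul0mx.
Qed.

Lemma hyperplaneZ k h : k != 0 -> hyperplane (k *: h) = hyperplane h.
Proof.
move=> k0; apply/vspaceP=> x; rewrite !mem_hyperplane linearZ /= -scalemxAr.
by rewrite scaler_eq0 (negPf k0).
Qed.

Lemma dim_capv U V : (\dim U + \dim V <= \dim (U :&: V) + 4)%N.
Proof.
rewrite -dimv_sum_cap addnC leq_add2l.
by apply: leq_trans (dimvS (subvf _)) _; rewrite dimvf /= dim_matrix.
Qed.

Lemma cap3_planes_gt0 U V W : \dim U = 3 -> \dim V = 3 -> \dim W = 3 ->
  (0 < \dim (U :&: V :&: W))%N.
Proof.
move=> dU dV dW; have := dim_capv U V; have := dim_capv (U :&: V) W.
by rewrite dU dV dW; move: (\dim _) (\dim _) => m n; lia.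
Qed.

(** If the equation [h1] depended on [h2] and [h3], its plane would contain the
  line of the other two. *)
Lemma hyperplanes_indep h1 h2 h3 (k1 k2 k3 : F) :
  h2 != 0 -> h3 != 0 ->
  \dim (hyperplane h1 :&: hyperplane h2 :&: hyperplane h3) = 1%N ->
  k1 *: h1 + k2 *: h2 + k3 *: h3 = 0 -> k1 = 0.
Proof.
move=> h20 h30 d E; apply/eqP/negPn/negP => k10.
have := dim_capv (hyperplane h2) (hyperplane h3).
rewrite !dim_hyperplane //.
suff /dimvS : (hyperplane h2 :&: hyperplane h3 <=
               hyperplane h1 :&: hyperplane h2 :&: hyperplane h3)%VS.
  by rewrite d; move: (\dim _) => n; lia.
rewrite -capvA subv_cap subvv andbT; apply/subvP=> x.
rewrite memv_cap !mem_hyperplane => /andP[/eqP x2 /eqP x3].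
have := congr1 (fun h => x *m h^T) E.
rewrite /= !linearD !linearZ /= x2 x3 !scaler0 !addr0 linear0 mulmx0 => /eqP.
by rewrite scaler_eq0 (negPf k10).
Qed.

Lemma vlineZ (k : F) x : k != 0 -> (<[k *: x]> = <[x]>)%VS.
Proof.
move=> k0; apply/eqP; rewrite eqEsubv -!memvE memvZ ?memv_line //=.
by apply/vlineP; exists k^-1; rewrite scalerA mulVf ?scale1r.
Qed.
End Hyperplanes.

(** * Planes osculating a twisted cubic *)

Section Osculating.
Variables (F : fieldType) (B : 'M[F]_4).
Hypothesis uB : B \in unitmx.
Implicit Types (a b c d e t k : F) (x v : 'rV[F]_4).

(** Over the complex numbers, planes whose equations run through a twisted cubic
  of the dual space are the osculating planes of a twisted cubic. *)
Definition osc_plane t : {vspace 'rV[F]_4} := hyperplane (moment 1 t *m B).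

(** The value at [t] of the cubic polynomial with coefficients [x *m B^T]: in
  these coordinates [osc_plane t] is the set of polynomials vanishing at [t]. *)
Definition ev t x : F := (moment 1 t *m (x *m B^T)^T) 0 0.

Lemma mem_osc_plane t x : (x \in osc_plane t) = (ev t x == 0).
Proof.
rewrite mem_hyperplane /ev -(inj_eq trmx_inj) !trmx_mul !trmxK trmx0 mulmxA.
apply/eqP/eqP => [->|E]; first by rewrite mxE.
by apply/matrixP=> i j; rewrite !ord1 E mxE.
Qed.

Lemma ev_linear t k x v : ev t (k *: x + v) = k * ev t x + ev t v.
Proof. by rewrite /ev mulmxDl -scalemxAl linearP /= mulmxDr -scalemxAr !mxE. Qed.

Lemma ev_inj a b c d x : uniq [:: a; b; c; d] ->
  ev a x = 0 -> ev b x = 0 -> ev c x = 0 -> ev d x = 0 -> x = 0.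
Proof.
move=> U xa xb xc xd; apply/eqP/negPn/negP => x0.
suff: (size [:: a; b; c; d] <= 3)%N by [].
apply: (@cubic_max_roots _ (x *m B^T)) => // [|t].
  apply: contra_neq x0 => x0.
  by rewrite -[x](@mulmxK _ _ _ B^T) ?unitmx_tr // x0 mul0mx.
move=> tU; apply/matrixP=> i j; rewrite !ord1 [RHS]mxE -/(ev t x).
by move: tU; rewrite !inE => /or4P[] /eqP->.
Qed.

(** The linear relation between the values of a cubic polynomial at five points,
  with the denominators of Lagrange's formula cleared. *)
Lemma ev_lagrange a b c d e x :
  let V t1 t2 t3 t4 :=
    (t1 - t2) * (t1 - t3) * (t1 - t4) * (t2 - t3) * (t2 - t4) * (t3 - t4) in
  ev a x * V b c d e - ev b x * V a c d e + ev c x * V a b d e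
    - ev d x * V a b c e + ev e x * V a b c d = 0.
Proof.
rewrite /ev /=; move: (x *m B^T) => z.
have E t : (moment 1 t *m z^T) 0 0 =
   z 0 ord0 + t * z 0 1 + t ^+ 2 * z 0 (inord 2) + t ^+ 3 * z 0 (inord 3).
  rewrite !mxE !big_ord_recl big_ord0 !mxE /= /bump /=.
  have -> : lift ord0 (ord0 : 'I_3) = 1 by apply/val_inj.
  have -> : lift ord0 (lift ord0 (ord0 : 'I_2)) = inord 2.
    by apply/val_inj; rewrite /= inordK.
  have -> : lift ord0 (lift ord0 (lift ord0 (ord0 : 'I_1))) = inord 3.
    by apply/val_inj; rewrite /= inordK.
  ring.
rewrite !E; ring.
Qed.

Lemma ev_cubic a b c :
  exists v, forall t, ev t v = (t - a) * (t - b) * (t - c).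
Proof.
exists (cubic a b c *m invmx (B^T)) => t.
by rewrite /ev mulmxKV ?unitmx_tr // moment_cubic.
Qed.

Lemma dim_osc_plane t : \dim (osc_plane t) = 3.
Proof.
rewrite dim_hyperplane //.
have m0 : moment 1 t != 0.
  apply/eqP => /rowP /(_ 0); rewrite !mxE expr1n expr0 mulr1 => /eqP.
  by rewrite oner_eq0.
by apply: contra_neq m0 => E; rewrite -[moment 1 t](mulmxK uB) E mul0mx.
Qed.

Lemma cap4_osc_plane a b c d : uniq [:: a; b; c; d] ->
  (osc_plane a :&: osc_plane b :&: osc_plane c :&: osc_plane d = 0)%VS.
Proof.
move=> U; apply/eqP; rewrite -subv0; apply/subvP=> x.
rewrite !memv_cap !mem_osc_plane -!andbA.
move=> /and4P[/eqP xa /eqP xb /eqP xc /eqP xd].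
by rewrite memv0 (ev_inj U xa xb xc xd).
Qed.

Lemma dim_cap_osc_plane a b c d : uniq [:: a; b; c; d] ->
  \dim (osc_plane a :&: osc_plane b) = 2 /\
  \dim (osc_plane a :&: osc_plane b :&: osc_plane c) = 1%N.
Proof.
move=> U.
have := dim_capv (osc_plane a :&: osc_plane b :&: osc_plane c) (osc_plane d).
have := dim_capv (osc_plane a :&: osc_plane b) (osc_plane c).
have := dim_capv (osc_plane a) (osc_plane b).
rewrite cap4_osc_plane // !dim_osc_plane dimv0.
by move: (\dim _) (\dim _) => m n; lia.
Qed.

(** The point common to the planes at [c], [d], [e] is the polynomial
  [(X - c) (X - d) (X - e)], and the line common to the planes at [a] and [b] is
  cut out by the values at [a] and [b]; so the plane they span fixes the ratio of
  those two values. *)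
Lemma span_line_point a b c d e : uniq [:: a; b; c; d; e] ->
  let S := ((osc_plane a :&: osc_plane b) +
            (osc_plane c :&: osc_plane d :&: osc_plane e))%VS in
  \dim S = 3 /\
  forall x, (x \in S) = (ev a x * ((b - c) * (b - d) * (b - e)) ==
                         ev b x * ((a - c) * (a - d) * (a - e))).
Proof.
move=> U S; have [Uac Ubc] : uniq [:: c; d; e; a] /\ uniq [:: a; b; c; d].
  move: U; rewrite /= !inE !negb_or -!andbA.
  case/and5P=> ? ? ? ? /and5P[? ? ? ?] /and3P[? ? _].
  by rewrite ![_ == a]eq_sym; split; repeat (apply/andP; split).
have [ac ad ae [cd ce de]] :
    [/\ a != c, a != d, a != e & [/\ c != d, c != e & d != e]].
  move: U; rewrite /= !inE !negb_or -!andbA.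
  by case/and5P=> ? ? ? ? /and5P[? ? ? ?] /and3P[? ? _].
have [d2 _] := dim_cap_osc_plane Ubc; have [_ d1] := dim_cap_osc_plane Uac.
have dS : \dim S = 3.
  have := dimv_sum_cap (osc_plane a :&: osc_plane b)
                       (osc_plane c :&: osc_plane d :&: osc_plane e).
  rewrite d1 d2 -/S.
  suff -> : (osc_plane a :&: osc_plane b :&:
             (osc_plane c :&: osc_plane d :&: osc_plane e) = 0)%VS.
    by rewrite dimv0 addn0.
  apply/eqP; rewrite -subv0 -(cap4_osc_plane Uac); apply/subvP=> x.
  by rewrite !memv_cap => /andP[/andP[-> _] ->].
split=> // x; apply/idP/eqP => [/memv_addP[y yab [v vcde ->]]|E].
  move: yab vcde; rewrite !memv_cap !mem_osc_plane -!andbA.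
  move=> /andP[/eqP ya /eqP yb] /and3P[/eqP vc /eqP vd /eqP ve].
  rewrite -[y]scale1r !ev_linear ya yb !mulr0 !add0r.
  (* Three of the five terms of Lagrange's relation vanish. *)
  apply: (@mulIf _ ((c - d) * (c - e) * (d - e))).
    by rewrite !mulf_neq0 ?subr_eq0.
  have /= := ev_lagrange a b c d e v.
  rewrite vc vd ve !mul0r subr0 !addr0 => /eqP.
  rewrite subr_eq0 => /eqP L; rewrite -!mulrA in L *; exact: L.
have [v Ev] := ev_cubic c d e.
pose k := ev a x / ((a - c) * (a - d) * (a - e)).
have w0 : (a - c) * (a - d) * (a - e) != 0 by rewrite !mulf_neq0 ?subr_eq0.
rewrite -[x](subrK (k *: v)) memv_add //.
  rewrite memv_cap !mem_osc_plane addrC -scaleNr !ev_linear !Ev.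
  rewrite {1}/k mulNr divfK // addNr eqxx /= addrC mulNr subr_eq0 /k.
  by rewrite mulrAC E mulfK.
by rewrite memvZ // !memv_cap !mem_osc_plane !Ev !(subrr, mulr0, mul0r) eqxx.
Qed.

(** The theorem for osculating planes.  Three ratios determine the values
  [y1, y2, y3, y4] at [t1, t2, t3, t4] up to a common factor [k], and Lagrange's
  relation then gives the value at [t]. *)
Lemma span_planes_meet t1 t2 t3 t4 t5 t6 t :
  uniq [:: t1; t2; t3; t4; t5; t6; t] ->
  let K := osc_plane in
  let S1 := ((K t1 :&: K t2) + (K t4 :&: K t5 :&: K t))%VS in
  let S2 := ((K t2 :&: K t3) + (K t5 :&: K t6 :&: K t))%VS in
  let S3 := ((K t3 :&: K t4) + (K t6 :&: K t1 :&: K t))%VS in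
  [/\ \dim S1 = 3, \dim S2 = 3 & \dim S3 = 3] /\
  \dim (S1 :&: S2 :&: S3) = 1%N /\ (S1 :&: S2 :&: S3 <= K t)%VS.
Proof.
move=> U K S1 S2 S3.
have N (r s : F) : r != s -> s != r by rewrite eq_sym.
move: U; rewrite /= !inE !negb_or -!andbA.
do 20! (case/andP=> /[dup] /N ? ?); case/andP=> /[dup] /N ? ? _.
have [|d1 mem1] := @span_line_point t1 t2 t4 t5 t.
  by rewrite /= !inE !negb_or; repeat (apply/andP; split).
have [|d2 mem2] := @span_line_point t2 t3 t5 t6 t.
  by rewrite /= !inE !negb_or; repeat (apply/andP; split).
have [|d3 mem3] := @span_line_point t3 t4 t6 t1 t.
  by rewrite /= !inE !negb_or; repeat (apply/andP; split).
pose y1 := (t1 - t4) * (t1 - t5) * (t2 - t6) * (t3 - t1) * (t1 - t).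
pose y2 := (t2 - t4) * (t2 - t5) * (t2 - t6) * (t3 - t1) * (t2 - t).
pose y3 := (t3 - t5) * (t3 - t6) * (t2 - t4) * (t3 - t1) * (t3 - t).
pose y4 := (t3 - t5) * (t2 - t4) * (t4 - t6) * (t4 - t1) * (t4 - t).
have y10 : y1 != 0 by rewrite !mulf_neq0 ?subr_eq0.
have evW x : x \in (S1 :&: S2 :&: S3)%VS -> exists k,
    [/\ ev t1 x = k * y1, ev t2 x = k * y2, ev t3 x = k * y3,
        ev t4 x = k * y4 & ev t x = 0].
  rewrite !memv_cap mem1 mem2 mem3 => /andP[/andP[/eqP E1 /eqP E2] /eqP E3].
  pose k := ev t1 x / y1; exists k.
  have e1 : ev t1 x = k * y1 by rewrite divfK.
  have e2 : ev t2 x = k * y2.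
    apply: (@mulIf _ ((t1 - t4) * (t1 - t5) * (t1 - t))).
      by rewrite !mulf_neq0 ?subr_eq0.
    rewrite -E1 e1 /y1 /y2; ring.
  have e3 : ev t3 x = k * y3.
    apply: (@mulIf _ ((t2 - t5) * (t2 - t6) * (t2 - t))).
      by rewrite !mulf_neq0 ?subr_eq0.
    rewrite -E2 e2 /y3 /y2; ring.
  have e4 : ev t4 x = k * y4.
    apply: (@mulIf _ ((t3 - t6) * (t3 - t1) * (t3 - t))).
      by rewrite !mulf_neq0 ?subr_eq0.
    rewrite -E3 e3 /y3 /y4; ring.
  split=> //.
  apply: (@mulIf _ ((t1 - t2) * (t1 - t3) * (t1 - t4) * (t2 - t3)
                    * (t2 - t4) * (t3 - t4))).
    by rewrite !mulf_neq0 ?subr_eq0.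
  have /= := ev_lagrange t1 t2 t3 t4 t x; rewrite e1 e2 e3 e4 mul0r => <-.
  rewrite /y1 /y2 /y3 /y4; ring.
split; first by []; split; last first.
  by apply/subvP=> x /evW[k [_ _ _ _ xt]]; rewrite mem_osc_plane xt.
apply/eqP; rewrite eqn_leq; apply/andP; split; last exact: cap3_planes_gt0.
set W := (_ :&: _ :&: _)%VS; pose x := vpick W.
have [k [x1 x2 x3 x4 _]] : exists k,
    [/\ ev t1 x = k * y1, ev t2 x = k * y2, ev t3 x = k * y3,
        ev t4 x = k * y4 & ev t x = 0].
  exact: evW (memv_pick _).
have U4 : uniq [:: t1; t2; t3; t4].
  by rewrite /= !inE !negb_or; repeat (apply/andP; split).
have [k0|k0] := eqVneq k 0.
  have : x = 0 by apply: (ev_inj U4); rewrite ?x1 ?x2 ?x3 ?x4 k0 mul0r.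
  by move/eqP; rewrite vpick0 => /eqP->; rewrite dimv0.
apply: (@leq_trans (\dim <[x]>)); last by rewrite dim_vline leq_b1.
apply/dimvS/subvP => v /evW[l [v1 v2 v3 v4 _]].
have -> : v = (l / k) *: x; last by rewrite memvZ ?memv_line.
apply/eqP; rewrite -subr_eq0 addrC -scaleNr; apply/eqP.
by apply: (ev_inj U4);
  rewrite ev_linear ?x1 ?x2 ?x3 ?x4 ?v1 ?v2 ?v3 ?v4 mulNr mulrA divfK // addNr.
Qed.
End Osculating.

(** * Affine parameters *)

(** The substitution [s := s + c t] on cubic forms. *)
Definition translation (F : fieldType) (c : F) : 'M[F]_4 :=
  \matrix_(i < 4, k < 4) (nth [::] [:: [:: 1; 0; 0; 0];
                                       [:: 3 * c; 1; 0; 0];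
                                       [:: 3 * c ^+ 2; 2 * c; 1; 0];
                                       [:: c ^+ 3; c ^+ 2; c; 1]] i)`_k.

Lemma translation_unit (F : fieldType) (c : F) : translation c \in unitmx.
Proof.
rewrite unitmxE unitfE det_trig.
  apply/prodf_neq0 => i _; rewrite !mxE.
  by case: i => [[|[|[|[|//]]]] ?]; rewrite /= oner_eq0.
apply/is_trig_mxP => i k; rewrite !mxE.
by case: i k => [[|[|[|[|//]]]] ?] [[|[|[|[|//]]]] ?].
Qed.

Lemma moment_translation (F : fieldType) (c s t : F) :
  moment s t *m translation c = moment (s + c * t) t.
Proof.
apply/rowP=> k; rewrite !mxE !big_ord_recl big_ord0 !mxE.
case: k => [[|[|[|[|//]]]] ?];
  rewrite /= /bump /= !(add1n, addn0, subSS, subn0, subnn); ring.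
Qed.

Section Chart.
Variable F : numFieldType.

Lemma avoid_roots n (s t : 'I_n -> F) : (forall k, (s k, t k) != (0, 0)) ->
  exists c, forall k, s k + c * t k != 0.
Proof.
move=> st0; pose p := \prod_k ((s k)%:P + t k *: 'X).
have p0 : p != 0.
  apply/prodf_neq0 => k _; apply: contra_neq (st0 k) => /polyP E.
  have := E 0%N; have := E 1%N.
  by rewrite !coefE mulr0 mulr1 addr0 add0r => -> ->.
pose rs : seq F := [seq i%:R | i <- iota 0 (size p)].
have [|/allPn[c _ pc]] := boolP (all (root p) rs).
  move/(max_poly_roots p0); rewrite size_map size_iota ltnn.
  rewrite map_inj_uniq ?iota_uniq => [/(_ isT)//|i j /eqP].
  by rewrite eqr_nat => /eqP.
exists c => k; apply: contraNneq pc => ck.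
rewrite rootE horner_prod (bigD1 k) //= !hornerE mulrC.
by rewrite (mulrC (t k)) ck mulr0.
Qed.

(** A projective change of the parameter moves finitely many points of the curve
  away from infinity. *)
Lemma affine_chart n (s t : 'I_n -> F) : (forall k, (s k, t k) != (0, 0)) ->
  exists2 M : 'M[F]_4, M \in unitmx &
    exists u l : 'I_n -> F, forall k,
      l k != 0 /\ moment (s k) (t k) = l k *: (moment 1 (u k) *m M).
Proof.
move=> /avoid_roots[c c0]; have uT := translation_unit c.
exists (invmx (translation c)); first by rewrite unitmx_inv.
exists (fun k => t k / (s k + c * t k)), (fun k => (s k + c * t k) ^+ 3) => k.
split; first by rewrite expf_neq0.
rewrite scalemxAl -[LHS](mulmxK uT) moment_translation; congr (_ *m _).
apply/rowP=> j; rewrite !mxE; have := c0 k; set r := s k + _ => r0.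
rewrite expr1n mul1r; case: j => [[|[|[|[|//]]]] ?];
  rewrite /= !(subSS, subn0); by field.
Qed.
End Chart.

(** * The Fano plane *)

Section Fano.
Implicit Types (a b c k l : 'I_7) (A : {set 'I_7}).

Lemma card_ordered_pairs A :
  #|[set p : 'I_7 * 'I_7 | [&& p.1 != p.2, p.1 \in A & p.2 \in A]]|
  = (#|A| * #|A|.-1)%N.
Proof.
have -> : [set p : 'I_7 * 'I_7 | [&& p.1 != p.2, p.1 \in A & p.2 \in A]] =
   setX A A :\: [set (a, a) | a in A].
  apply/setP=> -[a b]; rewrite !inE /=; case: (eqVneq a b) => [->|ab] /=.
    apply/esym/negbTE; rewrite negb_and negbK andbb.
    by case: (boolP (b \in A)) => bA; rewrite ?orbT // imset_f.
  suff /negbTE -> : (a, b) \notin [set (x, x) | x in A] by [].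
  by apply/imsetP=> -[x _ [ax bx]]; rewrite ax bx eqxx in ab.
rewrite cardsD cardsX (setIidPr _) => [|].
  rewrite card_imset => [|x y []//].
  by case: #|A| => // n; rewrite mulnS addKn mulnC.
by apply/subsetP=> _ /imsetP[a aA ->]; rewrite inE /= aA.
Qed.

(** Double counting of ordered pairs of distinct points: there are 42, each lies
  in some [L k], and each of the seven sets contains at most 6 of them. *)
Lemma fano_of_cover (L : 'I_7 -> {set 'I_7}) :
  (forall k, #|L k| <= 3)%N ->
  (forall a b, a != b -> exists k, a \in L k /\ b \in L k) ->
  (forall k, #|L k| = 3%N) /\
  (forall a b k l, a != b ->
     a \in L k -> b \in L k -> a \in L l -> b \in L l -> k = l).
Proof.
move=> L3 cov; pose D : pred ('I_7 * 'I_7) := fun p => p.1 != p.2.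
pose N (p : 'I_7 * 'I_7) := #|[set k | (p.1 \in L k) && (p.2 \in L k)]|.
have E : (\sum_k #|L k| * #|L k|.-1 = \sum_(p | D p) N p)%N.
  under eq_bigr => k _ do rewrite -card_ordered_pairs -sum1_card.
  under [RHS]eq_bigr => p _ do rewrite /N -sum1_card.
  rewrite (exchange_big_dep D) /= => [|k p _]; last by rewrite inE => /andP[].
  apply: eq_bigr => p Dp; apply: eq_bigl => k; rewrite !inE.
  by rewrite -/(D p) Dp.
have cD : (\sum_(p | D p) 1 = 42)%N.
  rewrite sum1_card; have := card_ordered_pairs setT.
  rewrite cardsT card_ord -[RHS]/42%N => <-.
  by apply: eq_card => p; rewrite !inE /= andbT.
have hi : (\sum_k #|L k| * #|L k|.-1 <= \sum_(k : 'I_7) 6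
             ?= iff [forall k, #|L k| == 3])%N.
  by apply: leqif_sum => k _; split; have := L3 k; case: #|L k| => [|[|[|[|]]]].
have lo : (\sum_(p | D p) 1 <= \sum_(p | D p) N p
             ?= iff [forall (p | D p), 1 == N p])%N.
  apply: leqif_sum => p Dp; split=> //; rewrite card_gt0; apply/set0Pn.
  by have [k [pk qk]] := cov _ _ Dp; exists k; rewrite inE pk.
have e42 : (\sum_k #|L k| * #|L k|.-1 = 42)%N.
  apply/eqP; rewrite eqn_leq; have := hi.1; have := lo.1.
  by rewrite cD -E sum_nat_const card_ord => -> ->.
have [_ hi2] := hi; have [_ lo2] := lo.
move: hi2 lo2; rewrite -E e42 cD sum_nat_const card_ord !eqxx.
move=> /esym/forallP h3 /esym/forall_inP h1; split=> [k|a b k l ab ak bk al bl].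
  exact/eqP.
have := h1 (a, b) ab; rewrite eq_sym => /cards1P[m /setP mE].
have := mE k; have := mE l; rewrite !inE /= ak bk al bl.
by move=> /esym/eqP -> /esym/eqP ->.
Qed.

(** Uniqueness of the Fano plane: choose [p] and let [(a, a')], [(b, b')],
  [(c, c')] be the pairs cut by the lines through it, with [c] and [c'] named so
  that [a], [b], [c] are collinear.  The other lines are then forced. *)
Lemma fano_labelling (L : 'I_7 -> {set 'I_7}) :
  (forall k, #|L k| = 3%N) ->
  (forall a b, a != b -> exists k, a \in L k /\ b \in L k) ->
  (forall a b k l, a != b ->
     a \in L k -> b \in L k -> a \in L l -> b \in L l -> k = l) ->
  exists p a a' b b' c c' : 'I_7,
  let Ts := [:: [set a; b; c]; [set a; b'; c'];
                [set a'; b; c']; [set a'; b'; c];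
                [set p; a; a']; [set p; b; b']; [set p; c; c']] in
  [/\ uniq [:: a; a'; b; b'; c; c'; p],
      {in Ts, forall T, exists k, L k = T} & forall k, L k \in Ts].
Proof.
move=> L3 cov uni.
pose col x y z := [/\ x != y, x != z & y != z] /\
                  exists k, [/\ x \in L k, y \in L k & z \in L k].
have colL x y z : col x y z -> exists k, L k = [set x; y; z].
  case=> -[xy xz yz] [k [xk yk zk]]; exists k; apply/esym/eqP.
  rewrite eqEcard L3 !subUset !sub1set xk yk zk /=.
  by rewrite setUC cardsU1 cards2 xy !inE negb_or eq_sym xz eq_sym yz.
have third x y : x != y -> exists z, col x y z.
  move=> xy; have [k [xk yk]] := cov _ _ xy.
  have : #|L k :\: [set x; y]| == 1%N.
    have := cardsD (L k) [set x; y].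
    rewrite L3 (setIidPr _) ?cards2 ?xy => [->//|].
    by rewrite subUset !sub1set xk yk.
  case/cards1P=> z /setP /(_ z).
  rewrite !inE eqxx negb_or => /andP[/andP[zx zy] zk].
  by exists z; split; [rewrite xy eq_sym zx eq_sym zy | exists k].
have c1 x y z : col x y z -> col y x z.
  by case=> -[xy xz yz] [k [? ? ?]]; split; [rewrite eq_sym|exists k].
have c2 x y z : col x y z -> col x z y.
  by case=> -[xy xz yz] [k [? ? ?]]; split; [rewrite [z == y]eq_sym|exists k].
have c3 x y z (H : col x y z) : col y z x := c2 _ _ _ (c1 _ _ _ H).
have U x y z w : col x y z -> col x y w -> z = w.
  move=> Hz; case: (Hz) (colL _ _ _ Hz).
  move=> -[xy xz yz] _ [k kE] [[_ xw yw] [l [xl yl wl]]].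
  have E : k = l by apply: (uni x y); rewrite // kE !inE eqxx ?orbT.
  move: wl; rewrite -E kE !inE ![w == _]eq_sym (negPf xw) (negPf yw).
  by move/eqP.
have Uf x y z w : col x y z -> col x y w -> z != w -> False.
  by move=> H1 H2; rewrite (U _ _ _ _ H1 H2) eqxx.
have ne x y z : col x y z -> [/\ x != y, x != z & y != z] by case.
have out (s : seq 'I_7) : (size s < 7)%N -> exists x, x \notin s.
  move=> ls; apply/existsP; rewrite -negb_forall; apply: contraL ls => /forallP H.
  rewrite -leqNgt -[X in (X <= _)%N](card_ord 7); apply: leq_trans (card_size s).
  by apply/subset_leq_card/subsetP=> x _; apply: H.
have full (s : seq 'I_7) x : uniq s -> size s = 7%N -> x \in s.
  move=> us ss.
  have sub : {subset s <= enum 'I_7} by move=> y _; rewrite mem_enum.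
  have [|_ ->] := uniq_min_size us sub; last by rewrite mem_enum.
  by rewrite size_enum_ord ss.
have [p _] := out [::] isT.
have [a] := out [:: p] isT; rewrite inE => ap.
have [|a' pa] := third p a; first by rewrite eq_sym.
have [b] := out [:: p; a; a'] isT; rewrite !inE !negb_or => /and3P[bp ba ba'].
have [|b' pb] := third p b; first by rewrite eq_sym.
have [c0] := out [:: p; a; a'; b; b'] isT.
rewrite !inE !negb_or => /and5P[c0p c0a c0a' c0b c0b'].
have [|c0' pc0] := third p c0; first by rewrite eq_sym.
have [_ pa'0 aa'] := ne _ _ _ pa; have [_ pb'0 bb'] := ne _ _ _ pb.
have [_ pc'0 cc'0] := ne _ _ _ pc0.
have b'a : b' != a.
  apply/eqP=> E; apply: (Uf p a a' b) => //; last by rewrite eq_sym.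
  by rewrite -E; exact: c2.
have b'a' : b' != a'.
  apply/eqP=> E; apply: (Uf p a' a b); [exact: c2 | | by rewrite eq_sym].
  by rewrite -E; exact: c2.
have dc x x' : col p x x' -> c0 != x -> c0 != x' -> c0' != x /\ c0' != x'.
  move=> px cx cx'; split; apply/eqP=> E.
    apply: (Uf p x x' c0) => //; last by rewrite eq_sym.
    by rewrite -E; exact: c2.
  apply: (Uf p x' x c0); [exact: c2 | | by rewrite eq_sym].
  by rewrite -E; exact: c2.
have [c'a c'a'] := dc _ _ pa c0a c0a'.
have [c'b c'b'] := dc _ _ pb c0b c0b'.
have U0 : uniq [:: a; a'; b; b'; c0; c0'; p].
  rewrite /= !inE !negb_or.
  by repeat (apply/andP; split); rewrite // eq_sym.
(* A line through x and y, taken on two different lines through p, meets the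
   third line through p. *)
have cross x x' y y' : col p x x' -> col p y y' ->
    y != x -> y != x' -> y' != x -> y' != x' -> forall z, col x y z ->
    [/\ z != x, z != x', z != y, z != y' & z != p].
  move=> px py yx yx' y'x y'x' z xyz.
  have [xy xz yz] := ne _ _ _ xyz.
  rewrite [z == x]eq_sym [z == y]eq_sym.
  split=> //; apply/eqP=> E; rewrite {}E in xyz xz yz.
  - apply: (Uf x x' p y); [exact: c3 px | exact: c2 xyz |].
    by have [] := ne _ _ _ py.
  - apply: (Uf y y' p x); [exact: c3 py | by apply: c2; exact: c1 xyz |].
    by have [] := ne _ _ _ px.
  - by apply: (Uf p x x' y); [| by apply: c1; apply: c2 | rewrite eq_sym].
have [c [c' [abc pc U1]]] : exists c c',
    [/\ col a b c, col p c c' & uniq [:: a; a'; b; b'; c; c'; p]].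
  have [|z abz] := third a b; first by rewrite eq_sym.
  have [za za' zb zb' zp] := cross _ _ _ _ pa pb ba ba' b'a b'a' _ abz.
  have := full _ z U0 erefl.
  rewrite !inE (negPf za) (negPf za') (negPf zb) (negPf zb') (negPf zp) orbF /=.
  case/orP=> /eqP E; rewrite {}E in abz; first by exists c0, c0'.
  exists c0', c0; split=> //; first exact: c2.
  suff /perm_uniq E : perm_eq [:: a; a'; b; b'; c0; c0'; p]
                              [:: a; a'; b; b'; c0'; c0; p].
    by move: U0; rewrite E.
  by apply/permP => P /=; do 4! congr (_ + _)%N; rewrite addnCA.
have Nq x y : x != y -> y != x by rewrite eq_sym.
move: (U1); rewrite /= !inE !negb_or -!andbA.
do 20! (case/andP=> /[dup] /Nq ? ?); case/andP=> /[dup] /Nq ? ? _.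
have third_c x x' y y' : col p x x' -> col p y y' ->
    y != x -> y != x' -> y' != x -> y' != x' ->
    (forall z, [/\ z != x, z != x', z != y, z != y' & z != p] ->
       z = c \/ z = c') ->
    col x y c \/ col x y c'.
  move=> px py yx yx' y'x y'x' H; have [|z xyz] := third x y.
    by rewrite eq_sym.
  by have [<-|<-] := H z (cross _ _ _ _ px py yx yx' y'x y'x' _ xyz); auto.
have rest z : [/\ z != a, z != a', z != b, z != b' & z != p] -> z = c \/ z = c'.
  case=> z1 z2 z3 z4 z5; have := full _ z U1 erefl.
  rewrite !inE (negPf z1) (negPf z2) (negPf z3) (negPf z4) (negPf z5) orbF /=.
  by case/orP=> /eqP ->; auto.
have ab'c' : col a b' c'.
  have [H|//] : col a b' c \/ col a b' c'.
    apply: (third_c a a' b' b) => //; first exact: c2.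
    by move=> z [*]; apply: rest.
  by case: (Uf a c b b') => //; apply: c2.
have a'bc' : col a' b c'.
  have [H|//] : col a' b c \/ col a' b c'.
    apply: (third_c a' a b b') => //; first exact: c2.
    by move=> z [*]; apply: rest.
  by case: (Uf b c a a') => //; apply: c3.
have a'b'c : col a' b' c.
  have [//|H] : col a' b' c \/ col a' b' c'.
    apply: (third_c a' a b' b) => //; [exact: c2 | exact: c2 |].
    by move=> z [*]; apply: rest.
  by case: (Uf b' c' a a') => //; apply: c3.
exists p, a, a', b, b', c, c'.
set Ts := [:: _; _; _; _; _; _; _].
have TsL : {in Ts, forall T, exists k, L k = T}.
  move=> T; rewrite !inE.
  by do 6! (case/orP=> [/eqP->|]; first exact: colL); move/eqP->; exact: colL.
split; [exact: U1 | exact: TsL | move=> k].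
have [x [y [xk yk xy]]] : exists x y, [/\ x \in L k, y \in L k & x != y].
  by apply/card_gt1P; rewrite L3.
(* Any two of the seven labels appear together in one of the seven triples. *)
have [T TTs /andP[xT yT]] : exists2 T, T \in Ts & (x \in T) && (y \in T).
  apply/hasP; move: xy; have := full _ x U1 erefl; have := full _ y U1 erefl.
  rewrite /= !inE.
  repeat match goal with
  | |- is_true (_ || _) -> _ => case/orP
  | |- is_true (_ == _) -> _ => move/eqP->
  end; by rewrite !eqxx ?orbT.
by have [l lT] := TsL _ TTs; rewrite (uni x y k l) // lT.
Qed.
End Fano.

(** * Seven planes through the points of a twisted cubic *)

Section SevenPlanes.
Variables (F : numFieldType) (A : 'M[F]_4) (tau : 'I_7 -> F).
Variable h : 'I_7 -> 'rV[F]_4.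
Hypotheses (uA : A \in unitmx) (tau_inj : injective tau).
Hypothesis h0 : forall k, h k != 0.
Implicit Types (a b c k l : 'I_7).

Definition curve_point a : {vspace 'rV[F]_4} := <[moment 1 (tau a) *m A]>%VS.
Definition plane k := hyperplane (h k).

(** The plane restricted to the curve. *)
Definition plane_cubic k := h k *m A^T.
Definition points_on k : {set 'I_7} := [set a | (curve_point a <= plane k)%VS].

Lemma plane_cubic_neq0 k : plane_cubic k != 0.
Proof.
apply: contra_neq (h0 k) => E.
by rewrite -[h k](@mulmxK _ _ _ A^T) ?unitmx_tr // -/(plane_cubic k) E mul0mx.
Qed.

Lemma in_points_on a k :
  (a \in points_on k) = (moment 1 (tau a) *m (plane_cubic k)^T == 0).
Proof.
by rewrite inE -memvE mem_hyperplane /plane_cubic trmx_mul trmxK mulmxA.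
Qed.

Lemma points_on_le3 k (s : seq 'I_7) :
  uniq s -> {subset s <= points_on k} -> (size s <= 3)%N.
Proof.
move=> us sL; rewrite -(size_map tau).
apply: (cubic_max_roots (plane_cubic_neq0 k)); first by rewrite map_inj_uniq.
by move=> _ /mapP[a /sL aL ->]; apply/eqP; rewrite -in_points_on.
Qed.

Lemma card_points_on_le3 k : (#|points_on k| <= 3)%N.
Proof.
rewrite cardE; apply: (@points_on_le3 k); rewrite ?enum_uniq // => x.
by rewrite mem_enum.
Qed.

Lemma plane_cubicE k a b c : uniq [:: a; b; c] ->
  a \in points_on k -> b \in points_on k -> c \in points_on k ->
  exists2 r, r != 0 & plane_cubic k = r *: cubic (tau a) (tau b) (tau c).
Proof.
move=> U aL bL cL; apply: cubic_of_roots (plane_cubic_neq0 k) _.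
  by rewrite -(map_inj_uniq tau_inj) in U.
by move=> t; rewrite !inE => /or3P[] /eqP->; apply/eqP; rewrite -in_points_on.
Qed.

(** Two of eight points of the line lie in the same of the seven planes, which
  then contains the line. *)
Lemma secant_in_plane a b : a != b ->
  (forall x : {vspace 'rV[F]_4}, \dim x = 1%N ->
     (x <= curve_point a + curve_point b)%VS -> exists k, (x <= plane k)%VS) ->
  exists k, a \in points_on k /\ b \in points_on k.
Proof.
move=> ab cov; pose v i := moment 1 (tau i) *m A.
pose w (i : 'I_8) := v a + i%:R *: v b.
have w0 i : w i != 0.
  apply/eqP => E.
  have : moment 1 (tau a) + i%:R *: moment 1 (tau b) = 0.
    apply: (can_inj (mulmxK uA)).
    by rewrite mul0mx mulmxDl -scalemxAl; exact: E.
  move=> /rowP {}E; have := E 0; have := E 1.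
  rewrite !mxE !expr1n !expr0 !mul1r !expr1 mulr1 => E1 E0.
  case/negP: ab; apply/eqP/tau_inj.
  have /eqP : (i%:R : F) = -1 by apply/eqP; rewrite -addr_eq0 addrC E0.
  by move/eqP => iE; move/eqP: E1; rewrite iE mulN1r subr_eq0 => /eqP.
have [f fP] : exists f : 'I_8 -> 'I_7, forall i, w i \in plane (f i).
  apply: (fin_all_exists (P := fun i k => w i \in plane k)) => i.
  have [||k kP] := cov <[w i]>%VS; first by rewrite dim_vline w0.
    by rewrite -memvE memv_add // ?memvZ ?memv_line.
  by exists k; rewrite memvE.
have /injectivePn[i [j ij fij]] : ~~ injectiveb f.
  by apply/injectiveP => /leq_card; rewrite !card_ord.
have wi := fP i; have wj := fP j; rewrite -fij in wj.
have vb : v b \in plane (f i).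
  have := rpredB wi wj.
  rewrite /w opprD addrACA subrr add0r -scalerBl rpredZeq.
  by rewrite subr_eq0 eqr_nat (negPf ij : (i == j :> nat) = false).
have va : v a \in plane (f i).
  by rewrite -[v a](addrK (i%:R *: v b)) rpredB ?memvZ.
by exists (f i); rewrite !inE -!memvE.
Qed.

Hypothesis cov : forall a b, a != b ->
  exists k, a \in points_on k /\ b \in points_on k.

Lemma card_points_on k : #|points_on k| = 3%N.
Proof. by have [-> _] := fano_of_cover card_points_on_le3 cov. Qed.

Hypothesis trip : forall k1 k2 k3, uniq [:: k1; k2; k3] ->
  \dim (plane k1 :&: plane k2 :&: plane k3) = 1%N.

Lemma plane_cubic_indep k1 k2 k3 r1 r2 r3 : uniq [:: k1; k2; k3] ->
  r1 *: plane_cubic k1 + r2 *: plane_cubic k2 + r3 *: plane_cubic k3 = 0 ->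
  r1 = 0.
Proof.
move=> U E.
apply: (hyperplanes_indep (h0 k2) (h0 k3) (trip U) (k2 := r2) (k3 := r3)).
apply: (can_inj (@mulmxK _ _ _ A^T _)); first by rewrite unitmx_tr.
by rewrite mul0mx !mulmxDl -!scalemxAl.
Qed.

(** If the pairs cut on the three lines through [x] were in involution, the three
  planes would share a line. *)
Lemma involution_det_neq0 x y1 z1 y2 z2 y3 z3 :
  uniq [:: x; y1; z1; y2; z2; y3; z3] ->
  (exists k, [/\ x \in points_on k, y1 \in points_on k & z1 \in points_on k]) ->
  (exists k, [/\ x \in points_on k, y2 \in points_on k & z2 \in points_on k]) ->
  (exists k, [/\ x \in points_on k, y3 \in points_on k & z3 \in points_on k]) ->
  involution_det (tau y1) (tau z1) (tau y2) (tau z2) (tau y3) (tau z3) != 0.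
Proof.
move=> U [k1 [x1 yk1 zk1]] [k2 [x2 yk2 zk2]] [k3 [x3 yk3 zk3]].
have four s k : uniq s -> all (fun a => a \in points_on k) s -> (size s <= 3)%N.
  by move=> us /allP; exact: points_on_le3.
move: (U); rewrite /= !inE !negb_or -!andbA.
do 20! (case/andP=> ?); case/andP=> ? _.
have U1 : uniq [:: x; y1; z1].
  by rewrite /= !inE !negb_or; repeat (apply/andP; split).
have U2 : uniq [:: x; y2; z2].
  by rewrite /= !inE !negb_or; repeat (apply/andP; split).
have U3 : uniq [:: x; y3; z3].
  by rewrite /= !inE !negb_or; repeat (apply/andP; split).
have k12 : k1 != k2.
  apply/eqP=> E; suff: (size [:: x; y1; z1; y2] <= 3)%N by [].
  apply: (four _ k1); last by rewrite /= x1 yk1 zk1 E yk2.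
  by rewrite /= !inE !negb_or; repeat (apply/andP; split).
have k13 : k1 != k3.
  apply/eqP=> E; suff: (size [:: x; y1; z1; y3] <= 3)%N by [].
  apply: (four _ k1); last by rewrite /= x1 yk1 zk1 E yk3.
  by rewrite /= !inE !negb_or; repeat (apply/andP; split).
have k23 : k2 != k3.
  apply/eqP=> E; suff: (size [:: x; y2; z2; y3] <= 3)%N by [].
  apply: (four _ k2); last by rewrite /= x2 yk2 zk2 E yk3.
  by rewrite /= !inE !negb_or; repeat (apply/andP; split).
have [r1 r10 e1] := plane_cubicE U1 x1 yk1 zk1.
have [r2 r20 e2] := plane_cubicE U2 x2 yk2 zk2.
have [r3 r30 e3] := plane_cubicE U3 x3 yk3 zk3.
apply/eqP => /(involution_det_eq0 (tau x)) [c1 [c2 [c3 [c0 E]]]].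
have E' : (c1 / r1) *: plane_cubic k1 + (c2 / r2) *: plane_cubic k2
          + (c3 / r3) *: plane_cubic k3 = 0.
  by rewrite e1 e2 e3 !scalerA !divfK.
have z (c r : F) : r != 0 -> c / r = 0 -> c = 0.
  by move=> r0 /eqP; rewrite mulf_eq0 invr_eq0 (negPf r0) orbF => /eqP.
case/negP: c0; apply/eqP; congr (_, _, _).
- apply: (z _ r1) => //; apply: plane_cubic_indep E'.
  by rewrite /= !inE !negb_or k12 k13 k23.
- apply: (z _ r2) => //.
  apply: (@plane_cubic_indep k2 k1 k3 _ (c1 / r1) (c3 / r3)).
    by rewrite /= !inE !negb_or eq_sym k12 k13 k23.
  by rewrite -E' [X in X + _]addrC.
- apply: (z _ r3) => //.
  apply: (@plane_cubic_indep k3 k1 k2 _ (c1 / r1) (c2 / r2)).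
    by rewrite /= !inE !negb_or ![k3 == _]eq_sym k12 k13 k23.
  by rewrite -E' -addrA addrC.
Qed.

Lemma plane_cubics_on_twisted_cubic :
  exists2 B : 'M[F]_4, B \in unitmx &
    forall k, on_twisted_cubic B (plane_cubic k).
Proof.
have [c3 uni] := fano_of_cover card_points_on_le3 cov.
have [p [a [a' [b [b' [c [c' [U TsL LTs]]]]]]]] := fano_labelling c3 cov uni.
have Nq (x y : 'I_7) : x != y -> y != x by rewrite eq_sym.
have inL T x y z : T \in [:: [set a; b; c]; [set a; b'; c'];
      [set a'; b; c']; [set a'; b'; c];
      [set p; a; a']; [set p; b; b']; [set p; c; c']] ->
    [&& x \in T, y \in T & z \in T] ->
    exists k, [/\ x \in points_on k, y \in points_on k & z \in points_on k].
  by move=> /TsL[k kT] /and3P[? ? ?]; exists k; rewrite kT.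
move: (U); rewrite /= !inE !negb_or -!andbA.
do 20! (case/andP=> /[dup] /Nq ? ?); case/andP=> /[dup] /Nq ? ? _.
have Q x y1 z1 y2 z2 y3 z3 T1 T2 T3 := fun U i1 j1 i2 j2 i3 j3 =>
  @involution_det_neq0 x y1 z1 y2 z2 y3 z3 U
    (inL T1 x y1 z1 i1 j1) (inL T2 x y2 z2 i2 j2) (inL T3 x y3 z3 i3 j3).
have tauU : uniq [:: tau a; tau a'; tau b; tau b'; tau c; tau c'; tau p].
  by rewrite -(map_inj_uniq tau_inj) in U.
have [||B uB [[B1 B2 B3 B4] [B5 B6 B7]]] := seven_cubics_on_twisted_cubic tauU.
- split.
  + apply: (Q a _ _ _ _ _ _ [set a; b; c] [set a; b'; c'] [set p; a; a']);
    rewrite /= !inE ?negb_or ?eqxx ?orbT //; by repeat (apply/andP; split).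
  + apply: (Q b _ _ _ _ _ _ [set a; b; c] [set a'; b; c'] [set p; b; b']);
    rewrite /= !inE ?negb_or ?eqxx ?orbT //; by repeat (apply/andP; split).
  + apply: (Q c _ _ _ _ _ _ [set a; b; c] [set a'; b'; c] [set p; c; c']);
    rewrite /= !inE ?negb_or ?eqxx ?orbT //; by repeat (apply/andP; split).
  + apply: (Q p _ _ _ _ _ _ [set p; a; a'] [set p; b; b'] [set p; c; c']);
    rewrite /= !inE ?negb_or ?eqxx ?orbT //; by repeat (apply/andP; split).
- split.
  + apply: (Q a' _ _ _ _ _ _ [set a'; b; c'] [set a'; b'; c] [set p; a; a']);
    rewrite /= !inE ?negb_or ?eqxx ?orbT //; by repeat (apply/andP; split).
  + apply: (Q b' _ _ _ _ _ _ [set a; b'; c'] [set a'; b'; c] [set p; b; b']);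
    rewrite /= !inE ?negb_or ?eqxx ?orbT //; by repeat (apply/andP; split).
  + apply: (Q c' _ _ _ _ _ _ [set a; b'; c'] [set a'; b; c'] [set p; c; c']);
    rewrite /= !inE ?negb_or ?eqxx ?orbT //; by repeat (apply/andP; split).
exists B => // k.
have on x y z : points_on k = [set x; y; z] -> x != y -> x != z -> y != z ->
    on_twisted_cubic B (cubic (tau x) (tau y) (tau z)) ->
    on_twisted_cubic B (plane_cubic k).
  move=> kE xy xz yz [s [t [r [r0 qE]]]].
  have Uxyz : uniq [:: x; y; z] by rewrite /= !inE negb_or xy xz yz.
  have [|||l l0 ->] := plane_cubicE (k := k) Uxyz;
    rewrite ?kE ?inE ?eqxx ?orbT //.
  by exists s, t, (l * r); split; [exact: mulf_neq0|rewrite qE scalerA].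
have := LTs k; rewrite !inE.
by do 6! (case/orP=> [/eqP/on|]; first by apply); move/eqP/on; apply.
Qed.

Lemma planes_osculate : exists B u,
  [/\ B \in unitmx, injective u & forall k, plane k = osc_plane B (u k)].
Proof.
have [B uB onB] := plane_cubics_on_twisted_cubic.
have /fin_all_exists[st stP] k : exists st : F * F,
    exists2 r, r != 0 & plane_cubic k = r *: (moment st.1 st.2 *m B).
  by have [s [t [r [r0 E]]]] := onB k; exists (s, t), r.
have [|M uM [u [l ul]]] :=
  @affine_chart F 7 (fun k => (st k).1) (fun k => (st k).2).
  move=> k; have [r r0 E] := stP k.
  apply: contra_neq (plane_cubic_neq0 k) => st0.
  rewrite E; case: (st k) st0 => s t /= [-> ->].
  suff -> : moment 0 0 = 0 :> 'rV[F]_4 by rewrite mul0mx scaler0.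
  apply/rowP=> j; rewrite !mxE.
  by case: j => [[|[|[|[|//]]]] ?]; rewrite /= ?expr0n ?mul0r ?mulr0.
pose B' := M *m B *m invmx A^T.
have hE k : exists2 r, r != 0 & h k = r *: (moment 1 (u k) *m B').
  have [r r0 E] := stP k; have [l0 mE] := ul k.
  exists (r * l k); first exact: mulf_neq0.
  rewrite -[h k](@mulmxK _ _ _ A^T) ?unitmx_tr // -/(plane_cubic k) E mE.
  by rewrite -!scalemxAl scalerA !mulmxA.
exists B', u; split.
- by rewrite !unitmx_mul uM uB unitmx_inv unitmx_tr.
- (* Equal parameters make two planes coincide; a third one meets them in a
     line. *)
  move=> k1 k2 E; apply/eqP/negPn/negP => k12.
  have [k3] : exists k3, k3 \notin [:: k1; k2].
    apply/existsP; rewrite -negb_forall; apply/negP => /forallP H.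
    have : (#|'I_7| <= size [:: k1; k2])%N.
      by apply: leq_trans (card_size _); apply/subset_leq_card/subsetP=> x _.
    by rewrite card_ord.
  rewrite !inE negb_or => /andP[k31 k32].
  have [r1 r10 e1] := hE k1; have [r2 r20 e2] := hE k2.
  case/eqP: r20.
  apply: (hyperplanes_indep (h0 k2) (h0 k3) (k2 := - r1) (k3 := 0)).
    apply: (trip (k1 := k1)).
    by rewrite /= !inE !negb_or k12 ![_ == k3]eq_sym k31 k32.
  rewrite e1 e2 E scale0r addr0 !scalerA mulrC -scalerDl.
  by rewrite mulNr subrr scale0r.
- by move=> k; have [r r0 E] := hE k; rewrite /plane E hyperplaneZ.
Qed.
End SevenPlanes.

(** * The spans of the seven planes *)

Local Close Scope ring_scope.

Theorem theorem6p3 (R : realType) (T : P3sub R -> Prop) (P H : 'I_7 -> P3sub R) :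
  twisted_cubic T ->
  injective P ->
  (forall a : 'I_7, T (P a)) ->
  (forall k : 'I_7, is_plane (H k)) ->
  covers_secants P H ->
  (forall k : 'I_7, #|[set a : 'I_7 | (P a <= H k)%VS]| = 3) /\
  (triples_meet_in_points H ->
   forall (I : {set 'I_7}) (i1 i2 i3 i4 i5 i6 j : 'I_7),
     I = [set i1; i2; i3; i4; i5; i6] ->
     [/\ (i1 < i2)%N, (i2 < i3)%N, (i3 < i4)%N, (i4 < i5)%N & (i5 < i6)%N] ->
     ~: I = [set j] ->
     let S1 := ((H i1 :&: H i2) + (H i4 :&: H i5 :&: H j))%VS in
     let S2 := ((H i2 :&: H i3) + (H i5 :&: H i6 :&: H j))%VS in
     let S3 := ((H i3 :&: H i4) + (H i6 :&: H i1 :&: H j))%VS in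
     [/\ is_plane S1, is_plane S2 & is_plane S3] /\
     is_point (S1 :&: S2 :&: S3)%VS /\ (S1 :&: S2 :&: S3 <= H j)%VS).
Proof.
move=> [A uA TA] Pinj TP Hpl Hcov.
have /fin_all_exists[st stP] a : exists st : R[i] * R[i],
    (st.1, st.2) != (0, 0)%R /\ P a = <[moment st.1 st.2 *m A]>%VS.
  by have [s [t [st0 Pa]]] := (TA (P a)).1 (TP a); exists (s, t).
have [|M uM [tau [l lP]]] := @affine_chart (R[i] : numFieldType) 7
  (fun a => (st a).1) (fun a => (st a).2).
  by move=> a; have [] := stP a.
have PE a : P a = curve_point (M *m A) tau a.
  have [_ ->] := stP a; have [l0 ->] := lP a.
  by rewrite -scalemxAl vlineZ // -mulmxA.
have tau_inj : injective tau.
  by move=> a b ab; apply: Pinj; rewrite !PE /curve_point ab.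
have /fin_all_exists2[h h0 HE] k : exists2 h, h != 0%R & H k = hyperplane h.
  exact: hyperplaneP (Hpl k).
have uMA : (M *m A)%R \in unitmx by rewrite unitmx_mul uM.
have cov a b : a != b -> exists k,
    a \in points_on (M *m A) tau h k /\ b \in points_on (M *m A) tau h k.
  move=> ab; apply: secant_in_plane => // x dx.
  rewrite -!PE => /(Hcov a b ab x dx)[k xk].
  by exists k; rewrite /plane -HE.
have onE k : [set a | (P a <= H k)%VS] = points_on (M *m A) tau h k.
  by apply/setP=> a; rewrite !inE PE HE.
split=> [k|Htrip I i1 i2 i3 i4 i5 i6 j IE [l12 l23 l34 l45 l56] Ij S1 S2 S3].
  by rewrite onE; apply: card_points_on.
have trip k1 k2 k3 : uniq [:: k1; k2; k3] ->
    \dim (plane h k1 :&: plane h k2 :&: plane h k3) = 1%N.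
  by rewrite /plane -!HE; exact: Htrip.
have [B [u [uB u_inj HB]]] := planes_osculate uMA tau_inj h0 cov trip.
have HK k : H k = osc_plane B (u k) by rewrite HE; exact: HB.
have U : uniq [:: i1; i2; i3; i4; i5; i6; j].
  rewrite -[_ :: _]/(rcons [:: i1; i2; i3; i4; i5; i6] j) rcons_uniq.
  apply/andP; split.
    have : j \in ~: I by rewrite Ij set11.
    by rewrite IE !inE !negb_or -!andbA.
  apply: (@map_uniq _ _ val); apply: (sorted_uniq ltn_trans ltnn).
  by rewrite /= l12 l23 l34 l45 l56.
rewrite -(map_inj_uniq u_inj) in U.
rewrite /is_plane /is_point /S1 /S2 /S3 !HK.
exact: span_planes_meet U.
Qed.
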